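(* There exists an infinite family of pairs $(G_t,H_t)$, $t\ge1$, of connected simple cubic graphs on $14+2t$ vertices such that, for every $t$, the graphs $G_t$ and $H_t$ are adjacency-cospectral, and their minimum genera differ: $$\gamma(G_t)=2,\qquad \gamma(H_t)=1.$$ In particular $\Gamma_{G_t}(x)\ne\Gamma_{H_t}(x)$ for every $t$, the polynomials differing already in their least exponent.
   Context: Cubic means $3$-regular. Adjacency-cospectral means that the adjacency matrices have the same spectrum with multiplicities. A dart of $G$ is an ordered pair $(u,v)$ with $uv\in E(G)$. A rotation system $\rho$ of $G$ assigns to each vertex $v$ a cyclic ordering of its neighbours; $\sigma_v(u)$ denotes the neighbour of $v$ following $u$. The face permutation on darts is $\phi_\rho(u,v)=(v,\sigma_v(u))$; its cycles are the faces of $\rho$, and $F(\rho)$ is their number. For a connected cubic graph on $n$ vertices the genus of $\rho$ is given by Euler's formula, $g(\rho)=1+\frac n4-\frac12F(\rho)$. The orientable genus polynomial is $\Gamma_G(x)=\sum_\rho x^{g(\rho)}$ over all $2^n$ rotation systems, and the minimum genus is $\gamma(G)=\min_\rho g(\rho)$, the least exponent of $\Gamma_G$. *)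

(* Defs.v *)
From HB Require Import structures.
From mathcomp Require Import all_boot all_order all_fingroup all_algebra all_field.

Set Implicit Arguments.
Unset Strict Implicit.
Unset Printing Implicit Defensive.

Import GRing.Theory Num.Theory.
Local Open Scope ring_scope.

Record sgraph (n : nat) := SGraph {
  adj : rel 'I_n;
  adj_sym : symmetric adj;
  adj_irr : irreflexive adj
}.

Section Graph.
Variables (n : nat) (G : sgraph n).

Definition nbrs (v : 'I_n) : {set 'I_n} := [set u | adj G v u].

Definition cubic : Prop := forall v, #|nbrs v| = 3%N.

Definition connected : Prop := forall u v, connect (adj G) u v.

Definition adjmx : 'M[algC]_n := \matrix_(i, j) (adj G i j)%:R.

(* [r v] plays the role of sigma_v: it cyclically permutes the neighbours of v
   (in a single cycle). Requiring it to fix every other vertex makes the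
   encoding of a rotation system unique, so cubic graphs have exactly 2 ^ n. *)
Definition rotation_axiom (r : {ffun 'I_n -> 'S_n}) : bool :=
  [forall v, perm_on (nbrs v) (r v) &&
     [forall u in nbrs v, porbit (r v) u == nbrs v]].

Definition rotation := {r : {ffun 'I_n -> 'S_n} | rotation_axiom r}.

Definition dart := {d : 'I_n * 'I_n | adj G d.1 d.2}.

Section Faces.
Variable rho : rotation.

Lemma face_subproof (d : dart) :
  adj G ((val d).2, val rho (val d).2 (val d).1).1
        ((val d).2, val rho (val d).2 (val d).1).2.
Proof.
case: d => -[u v] /= uv; have /forallP/(_ v)/andP[rv _] := valP rho.
have := perm_closed u rv; rewrite !inE => ->.
by rewrite adj_sym.
Qed.

Definition face (d : dart) : dart := Sub (_, _) (face_subproof d).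

Lemma face_inj : injective face.
Proof.
move=> d1 d2 /(congr1 val) /= [e2 e1]; apply: val_inj.
move: e1; rewrite e2 => /perm_inj e1.
by rewrite (surjective_pairing (val d1)) e1 e2 -surjective_pairing.
Qed.

Definition face_perm : {perm dart} := perm face_inj.

Definition nfaces : nat := #|porbits face_perm|.

(* Euler's formula with n vertices and 3n/2 edges, so the value is the genus
   only when G is connected and cubic. *)
Definition genus : rat := 1 + n%:R / 4%:R - (nfaces)%:R / 2%:R.

End Faces.

Definition min_genus_is (g : rat) : Prop :=
  (exists rho : rotation, genus rho = g) /\
  (forall rho : rotation, g <= genus rho).

(* For connected cubic G every [genus rho] is a natural number, and truncn
   only reads it as one. *)
Definition genus_poly : {poly int} :=
  \sum_(rho : rotation) 'X^(Num.truncn (genus rho)).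

End Graph.

(* Equal algebraic multiplicity of every complex number; algC suffices because
   the eigenvalues of an integer matrix are algebraic. *)
Definition cospectral (n : nat) (G H : sgraph n) : Prop :=
  forall a : algC, mup a (char_poly (adjmx G)) = mup a (char_poly (adjmx H)).

Definition least_exponent (p : {poly int}) : nat := find (predC1 0) p.

(* Main.v *)
Require Import Defs.
From mathcomp Require Import all_boot all_order all_fingroup all_algebra all_field.
From mathcomp Require Import zify ring.

(** Let G be the cube in which two opposite corners are each replaced by
    K_{3,3} minus a vertex, a cubic graph of order 16, and let H be obtained from
    G by Godsil-McKay switching on four vertices; then G and H are cospectral
    ([gm_cospectral]). Going through all rotation systems shows that G has at
    most 6 faces and H at most 8, and that both numbers occur
    ([cube_max_nfaces], [switched_max_nfaces]): the genera are 2 and 1.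

    The larger pairs arise by truncating, again and again, a vertex v that lies,
    like two of its neighbours, outside the switching set: the edges to these
    neighbours are subdivided and the two new vertices are joined, so that v
    becomes a triangle. The new vertices have no
    neighbour in the switching set, so truncation commutes with switching
    ([truncate_gm_switch]) and the pairs remain cospectral.

    Truncation also preserves the minimum genus: the order grows by 2, so the
    claim is that the maximum number of faces grows by exactly 1. Let phi be the
    face permutation of a rotation system of the truncated graph, and let d, d'
    be the two darts of the new edge. The product of phi with the two
    transpositions (d, phi d') and (d', phi d) is the face permutation after the
    new edge has been deleted, except that d and d' survive as a cycle of length
    two. The second transposition always splits a cycle, the first one splits or
    merges according to whether d and d' lie on the same face. Subdivision
    vertices do not change the number of faces, which gives
      faces (truncated) + 2 [d and d' on one face] = faces (original) + 1
    ([nfaces_lift]). So one gains at most one face ([truncate_nfaces_le]), and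
    exactly one when the rotation at the new vertices is chosen such that the
    triangle bounds a face ([truncate_nfaces_ex]).

    The count for the two base graphs evaluates the number of cycles of a
    permutation by removing its elements one at a time ([porbits_ncycles]).
    Doing this vertex by vertex shares the work between all rotation systems that
    agree on the vertices treated so far ([max_ncyclesP]). *)

Set Implicit Arguments.
Unset Strict Implicit.
Unset Printing Implicit Defensive.

Import GRing.Theory Num.Theory Order.TTheory.

(** * Cycles of permutations *)

Lemma porbits_mulr_tperm (T : finType) (s : {perm T}) x y :
  #|porbits (s * tperm x y)| + (x \notin porbit s y).*2 =
  #|porbits s| + (x != y).
Proof.
rewrite -porbitsV invMg tpermV -(porbitsV s) -porbits_mul_tperm.
by rewrite porbitV.
Qed.

Lemma mem_porbit1 (T : finType) (s : {perm T}) x : s x \in porbit s x.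
Proof. exact: (mem_porbit s 1). Qed.

(** The transposition takes [x] out of its cycle: [x] becomes a fixed point, and
    what was sent to [x] is now sent to [s x]. *)
Lemma porbits_cut (T : finType) (s : {perm T}) x :
  #|porbits (s * tperm x (s x))| = #|porbits s| + (s x != x).
Proof.
have := porbits_mulr_tperm s x (s x).
by rewrite porbit_sym mem_porbit1 addn0 eq_sym.
Qed.

Lemma porbit_step (T : finType) (s : {perm T}) x : porbit s (s x) = porbit s x.
Proof. by apply/eqP; rewrite eq_porbit_mem mem_porbit1. Qed.

Lemma porbit_sub (T : finType) (s : {perm T}) (A : {set T}) x :
  x \in A -> (forall y, y \in A -> s y \in A) -> porbit s x \subset A.
Proof.
move=> Ax sA; apply/subsetP => _ /porbitP[i ->].
by elim: i => [|i IH]; rewrite ?expg0 ?perm1 // expgSr permM sA.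
Qed.

Lemma porbit_morph (T T' : finType) (s : {perm T}) (s' : {perm T'})
    (A : {set T}) (f : T -> T') :
  (forall x, x \in A -> s x \in A) ->
  (forall x, x \in A -> f (s x) \in porbit s' (f x)) ->
  forall x y, x \in A -> y \in porbit s x -> f y \in porbit s' (f x).
Proof.
move=> sA fs x y Ax /porbitP[i ->].
suff: ((s ^+ i)%g x \in A) && (f ((s ^+ i)%g x) \in porbit s' (f x)) by case/andP.
elim: i => [|i /andP[IA IH]]; first by rewrite expg0 perm1 Ax porbit_id.
rewrite expgSr permM sA //=.
by move: (fs _ IA); rewrite -!eq_porbit_mem in IH * => /eqP ->.
Qed.

(** Removing the elements outside the image of [f] from the cycles of [s'] leaves
    the cycles of [s], plus the cycle [K] that avoids the image. The retraction [r],
    which follows [s'] up to steps of [s], is what keeps distinct cycles of [s]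
    distinct. *)
Lemma porbits_retract (T T' : finType) (s : {perm T}) (s' : {perm T'})
    (f : T -> T') (r : T' -> T) (a : T') :
  let K := porbit s' a in
  (forall x, f x \notin K) -> cancel f r ->
  (forall x, f (s x) \in porbit s' (f x)) ->
  (forall e, e \notin K -> r (s' e) \in porbit s (r e)) ->
  (forall e, e \notin K -> f (r e) \in porbit s' e) ->
  #|porbits s'| = #|porbits s|.+1.
Proof.
move=> K fK fr fs rs fre.
have KC e : e \in ~: K -> s' e \in ~: K.
  by rewrite !inE -!eq_porbit_mem porbit_step.
pose g (O : {set T}) := if [pick x in O] is Some x then porbit s' (f x) else set0.
have gE x : g (porbit s x) = porbit s' (f x).
  rewrite /g; case: pickP => [y|/(_ x)]; last by rewrite porbit_id.
  move=> xy; apply/eqP; rewrite eq_porbit_mem.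
  by apply: (porbit_morph (A := setT)) xy => // z _; exact: fs.
have -> : porbits s' = K |: g @: porbits s.
  apply/setP => O; rewrite !inE; apply/imsetP/orP => [[e _ ->]|[/eqP->|]].
  - case: (boolP (e \in K)) => eK; [left|right].
      by rewrite eq_porbit_mem.
    apply/imsetP; exists (porbit s (r e)); first exact: imset_f.
    by rewrite gE; apply/esym/eqP; rewrite eq_porbit_mem fre.
  - by exists a.
  - by case/imsetP => _ /imsetP[x _ ->] ->; rewrite gE; exists (f x).
rewrite cardsU1 card_in_imset; last first.
  move=> _ _ /imsetP[x _ ->] /imsetP[y _ ->]; rewrite !gE => /eqP.
  rewrite eq_porbit_mem => xy; apply/eqP; rewrite eq_porbit_mem.
  rewrite -(fr x) -(fr y); apply: (porbit_morph (A := ~: K) (f := r)) xy => //.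
    by move=> e; rewrite inE; exact: rs.
  by rewrite inE.
suff -> : K \notin g @: porbits s by [].
apply/imsetP => -[_ /imsetP[x _ ->]]; rewrite gE => /eqP.
by rewrite eq_sym eq_porbit_mem (negPf (fK x)).
Qed.

Definition subst (T : eqType) (e s t : T) := if t == e then s else t.

(** A pair [(e, s)] says that [e] is sent to [s]. Removing [e] redirects to [s]
    whatever was sent to [e]; a cycle is counted when its last element goes, which
    is then a fixed point. The first argument bounds the length of the list, whose
    tail changes at each call. *)
Fixpoint ncycles_rec (T : eqType) (k : nat) (l : seq (T * T)) : nat :=
  if k is k'.+1 then
    if l is (e, s) :: l' then
      (e == s) + ncycles_rec k' [seq (p.1, subst e s p.2) | p <- l']
    else 0
  else 0.
Definition ncycles (T : eqType) (l : seq (T * T)) := ncycles_rec (size l) l.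

Lemma ncycles_cons (T : eqType) (e s : T) l :
  ncycles ((e, s) :: l) = (e == s) + ncycles [seq (p.1, subst e s p.2) | p <- l].
Proof. by rewrite /ncycles /= size_map. Qed.

Lemma ncycles_inj (T T' : eqType) (h : T -> T') (l : seq (T * T)) :
  injective h -> ncycles [seq (h p.1, h p.2) | p <- l] = ncycles l.
Proof.
move=> hI; rewrite /ncycles size_map; move: (size l) => k.
elim: k l => // k IH [|[e s] l] //=.
rewrite (inj_eq hI) -IH -!map_comp; congr (_ + ncycles_rec _ _).
by apply: eq_map => p; rewrite /= /subst (inj_eq hI); case: ifP.
Qed.

(** Each removal multiplies [s] by the transposition of [porbits_cut], which adds a
    cycle unless the element was fixed. *)
Lemma porbits_ncycles (T : finType) (s : {perm T}) (e : seq T) :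
  uniq e -> (forall x, x \in e) ->
  #|porbits s| = ncycles [seq (x, s x) | x <- e].
Proof.
move=> eU eT.
have szT : size e = #|T|.
  by rewrite -(card_uniqP eU); apply: eq_card => x; rewrite eT.
have fix_e x : x \notin e -> s x = x by rewrite eT.
(* This form makes sense for every list outside which [s] is the identity. *)
suff : #|porbits s| + size e = ncycles [seq (x, s x) | x <- e] + #|T|.
  by rewrite szT => /addIn.
elim: e s eU fix_e {eT szT} => [|x e IH] s /=.
  move=> _ fix_s; have -> : s = 1%g by apply/permP => x; rewrite perm1 fix_s.
  rewrite addn0 /ncycles /= add0n /porbits card_imset //.
  move=> x y /eqP; rewrite eq_porbit_mem => /porbitP[i ->].
  by rewrite expg1n perm1.
case/andP=> xe eU fix_s; rewrite ncycles_cons.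
have -> : [seq (p.1, subst x (s x) p.2) | p <- [seq (y, s y) | y <- e]] =
   [seq (y, (s * tperm x (s x))%g y) | y <- e].
  rewrite -map_comp; apply/eq_in_map => y ye /=; congr (_, _).
  rewrite permM /subst; case: eqP => [->|/eqP]; first by rewrite tpermL.
  rewrite eq_sym => xsy; rewrite tpermD // (inj_eq perm_inj).
  by apply: contraNneq xe => ->.
have IH' : forall y, y \notin e -> (s * tperm x (s x))%g y = y.
  move=> y ye; rewrite permM; have [->|yx] := eqVneq y x; first by rewrite tpermR.
  rewrite (fix_s y) ?inE ?negb_or ?yx // tpermD // eq_sym //.
  by rewrite -(fix_s y) ?inE ?negb_or ?yx // (inj_eq perm_inj).
have := IH _ eU IH'; rewrite porbits_cut (eq_sym x).
by case: (s x == x) => /=; lia.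
Qed.

(** * Rotations of cubic graphs *)

Section Rotations.
Variables (n : nat) (G : sgraph n).
Hypothesis G3 : cubic G.

Lemma nbrs3 v a : adj G v a ->
  exists b c, [/\ a != b, a != c, b != c & nbrs G v = [set a; b; c]].
Proof.
move=> va; have /eqP/cards2P[b [c [bc E]]] : #|nbrs G v :\ a| = 2.
  by have := cardsD1 a (nbrs G v); rewrite G3 inE va add1n => -[].
exists b, c.
have : (b \in nbrs G v :\ a) && (c \in nbrs G v :\ a) by rewrite E !inE !eqxx orbT.
rewrite !inE => /andP[/andP[ba _] /andP[ca _]]; split=> //; rewrite 1?eq_sym //.
by rewrite -(setD1K (a := a) (A := nbrs G v)) ?inE // E setUA.
Qed.

Section Next.
Variable rho : rotation G.

Lemma rot_adj v u : adj G v u -> adj G v (val rho v u).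
Proof.
move=> vu; have /forallP/(_ v)/andP[rv _] := valP rho.
by have := perm_closed u rv; rewrite !inE vu.
Qed.

Lemma porbit_rot v u : adj G v u -> porbit (val rho v) u = nbrs G v.
Proof.
move=> vu; have /forallP/(_ v)/andP[_ /forall_inP/(_ u)] := valP rho.
by rewrite inE => /(_ vu)/eqP.
Qed.

Lemma rot_neq v u : adj G v u -> val rho v u != u.
Proof.
move=> vu; apply/eqP => E; have := G3 v; rewrite -(porbit_rot vu).
suff /subset_leq_card : porbit (val rho v) u \subset [set u].
  by rewrite cards1 => + E3; rewrite E3.
by apply: porbit_sub => [|w]; rewrite !inE // => /eqP->; rewrite E.
Qed.

Lemma rot_cube v u : adj G v u -> val rho v (val rho v (val rho v u)) = u.
Proof. by move=> vu; have := iter_porbit (val rho v) u; rewrite porbit_rot // G3. Qed.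

Lemma rot_cases v a b c : a != b -> a != c -> b != c -> nbrs G v = [set a; b; c] ->
  [/\ val rho v a = b, val rho v b = c & val rho v c = a] \/
  [/\ val rho v a = c, val rho v c = b & val rho v b = a].
Proof.
move=> ab ac bc E.
have adjE u : adj G v u = [|| u == a, u == b | u == c].
  by have := in_set (adj G v) u; rewrite -[finset _]/(nbrs G v) E !inE orbA => ->.
have va : adj G v a by rewrite adjE eqxx.
have vb : adj G v b by rewrite adjE eqxx orbT.
have vc : adj G v c by rewrite adjE eqxx !orbT.
have := rot_adj va; have := rot_adj vb; have := rot_adj vc.
rewrite !adjE (negPf (rot_neq va)) (negPf (rot_neq vb)) (negPf (rot_neq vc)) /= orbF.
have ne x y : x != y -> val rho v x != val rho v y by rewrite (inj_eq perm_inj).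
have := ne _ _ ab; have := ne _ _ ac; have := ne _ _ bc.
move=> n1 n2 n3 /orP[]/eqP Ec /orP[]/eqP Eb /orP[]/eqP Ea;
  move: n1 n2 n3; rewrite Ea Eb Ec ?eqxx //; by [left | right].
Qed.

End Next.

(** A fixed-point-free map of order three on three elements is a 3-cycle. *)
Lemma rotation_of (f : 'I_n -> 'I_n -> 'I_n) :
  (forall v u, adj G v u ->
     [/\ adj G v (f v u), f v u != u & f v (f v (f v u)) = u]) ->
  exists rho : rotation G, forall v u, adj G v u -> val rho v u = f v u.
Proof.
move=> fP; pose g v u := if adj G v u then f v u else u.
have gE v u : adj G v u -> g v u = f v u by rewrite /g => ->.
have gN v u : ~~ adj G v u -> g v u = u by rewrite /g => /negPf->.
have g3 v : cancel (g v) (g v \o g v).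
  move=> u /=; have [vu|vu] := boolP (adj G v u); last by rewrite !gN.
  have [v1 _ E] := fP _ _ vu; have [v2 _ _] := fP _ _ v1.
  by rewrite (gE _ _ vu) (gE _ _ v1) (gE _ _ v2).
pose r := [ffun v => perm (can_inj (g3 v))].
have rE v u : adj G v u -> r v u = f v u by rewrite ffunE permE; exact: gE.
have rP : rotation_axiom G r.
  apply/forallP => v; apply/andP; split.
    by apply/subsetP => u; rewrite !inE ffunE permE /g; case: ifP => // _ /eqP.
  apply/forall_inP => u; rewrite inE => vu.
  have [v1 n1 E] := fP _ _ vu; have [v2 n2 _] := fP _ _ v1.
  rewrite eqEcard G3; apply/andP; split.
    apply: porbit_sub => [|w]; rewrite !inE // => vw.
    by rewrite rE //; have [] := fP _ _ vw.
  have <- : #|[set u; f v u; f v (f v u)]| = 3.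
    rewrite -setUA !cardsU1 cards1 !inE negb_or eq_sym n1 [f v u == _]eq_sym n2 /=.
    case: eqVneq => //= E'; have [_ + _] := fP _ _ v2.
    by rewrite E -E' eqxx.
  apply/subset_leq_card/subsetP => w; rewrite !inE => /orP[/orP[]|]/eqP->.
  - exact: porbit_id.
  - by rewrite -rE // mem_porbit1.
  - have <- : r v (r v u) = f v (f v u) by rewrite !rE.
    by have := mem_porbit (r v) 2 u; rewrite expgS expg1 permM.
by exists (exist _ r rP).
Qed.

End Rotations.

(** * Truncating a vertex *)

Section Coding.
Variable n : nat.

(** [inl] codes the two new vertices of a truncated graph, which come first in the
    numbering, and [inr] its old ones. *)
Definition enc (s : bool + 'I_n) : 'I_(2 + n) :=
  match s with
  | inl i => lshift n (if i then ord0 else ord_max)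
  | inr u => rshift 2 u
  end.

Definition dec (k : 'I_(2 + n)) : bool + 'I_n :=
  match split k with inl j => inl (j == ord0) | inr u => inr u end.

Lemma encK : cancel enc dec.
Proof.
case=> [i|u]; rewrite /dec /=.
  by rewrite -[lshift _ _]/(unsplit (inl _)) unsplitK; case: i.
by rewrite -[rshift _ _]/(unsplit (inr _)) unsplitK.
Qed.

Lemma decK : cancel dec enc.
Proof.
move=> k; rewrite /dec; case: splitP => [j kj|u ku]; apply: val_inj => /=.
  by rewrite kj; case: j {kj} => [[|[|]]].
by rewrite ku.
Qed.

Lemma enc_inj : injective enc. Proof. exact: can_inj encK. Qed.
End Coding.
Arguments enc : simpl never.

Section Truncation.
Variables (n : nat) (G : sgraph n) (v : 'I_n) (e : bool -> 'I_n).

(** The new vertex [i] subdivides the edge between [v] and [e i]. *)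
Definition subdiv i u w := ((u == v) && (w == e i)) || ((u == e i) && (w == v)).

Definition tadj_code (a b : bool + 'I_n) : bool :=
  match a, b with
  | inl i, inl j => i != j
  | inl i, inr w => (w == v) || (w == e i)
  | inr w, inl i => (w == v) || (w == e i)
  | inr u, inr w => [&& adj G u w, ~~ subdiv true u w & ~~ subdiv false u w]
  end.

Lemma subdivC i u w : subdiv i u w = subdiv i w u.
Proof. by rewrite /subdiv orbC andbC [in X in _ || X]andbC. Qed.

Lemma tadj_sym : symmetric (fun a b => tadj_code (dec a) (dec b)).
Proof.
move=> a b; case: (dec a) (dec b) => [i|u] [j|w] //=; first by rewrite eq_sym.
by rewrite adj_sym subdivC (subdivC false).
Qed.

Lemma tadj_irr : irreflexive (fun a b => tadj_code (dec a) (dec b)).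
Proof. by move=> a; case: (dec a) => [i|u] /=; rewrite ?eqxx ?adj_irr. Qed.

Definition truncate : sgraph (2 + n) := SGraph tadj_sym tadj_irr.

Lemma truncE a b : adj truncate (enc a) (enc b) = tadj_code a b.
Proof. by rewrite /= !encK. Qed.

(** The neighbour met in the truncated graph when leaving [u] towards its old
    neighbour [w]; [back] recovers [w] from it. *)
Definition port u w : bool + 'I_n :=
  if subdiv true u w then inl true else if subdiv false u w then inl false else inr w.

Definition back u (s : bool + 'I_n) : 'I_n :=
  match s with inl i => if u == v then e i else v | inr w => w end.

Hypothesis ve : forall i, adj G v (e i).
Hypothesis e_neq : e true != e false.

Lemma e_inj : injective e.
Proof. by case=> [] [] // /eqP; rewrite ?(negPf e_neq) // eq_sym (negPf e_neq). Qed.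

Lemma v_neq i : (v == e i) = false.
Proof. by apply: contraTF (ve i) => /eqP <-; rewrite adj_irr. Qed.

Lemma subdiv_uniq i j u w : subdiv i u w -> subdiv j u w = (i == j).
Proof.
have ev k := v_neq k; rewrite /subdiv.
case/orP => /andP[/eqP-> /eqP->]; rewrite eqxx (eq_sym _ v) !ev ?(eq_sym _ v) ?ev /=.
  by rewrite orbF (inj_eq e_inj).
by rewrite andbT (inj_eq e_inj).
Qed.

Lemma port_subdiv i u w : subdiv i u w -> port u w = inl i.
Proof. by move=> h; rewrite /port !(subdiv_uniq _ h); case: i h. Qed.

Lemma port_adj u w : adj G u w -> tadj_code (inr u) (port u w).
Proof.
move=> uw; rewrite /port; case: ifP => [|h1]; last first.
  case: ifP => [|h2] /=; last by rewrite uw h1 h2.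
  by case/orP => /andP[/eqP-> _]; rewrite eqxx ?orbT.
by case/orP => /andP[/eqP-> _] /=; rewrite eqxx ?orbT.
Qed.

Lemma subdiv_back i u : tadj_code (inr u) (inl i) -> subdiv i u (back u (inl i)).
Proof.
rewrite /= /subdiv; case: (u =P v) => [->|_] /=; first by rewrite eqxx.
by move->; rewrite eqxx.
Qed.

Lemma subdiv_adj i u w : subdiv i u w -> adj G u w.
Proof. by case/orP => /andP[/eqP-> /eqP->]; rewrite // adj_sym. Qed.

Lemma back_adj u s : tadj_code (inr u) s -> adj G u (back u s).
Proof.
case: s => [i|w]; first by move/subdiv_back/subdiv_adj.
by case/and3P.
Qed.

Lemma backK u s : tadj_code (inr u) s -> port u (back u s) = s.
Proof.
case: s => [i|w]; first by move/subdiv_back/port_subdiv.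
by rewrite /= /port => /and3P[_ /negPf-> /negPf->].
Qed.

Lemma portK u w : back u (port u w) = w.
Proof.
have hb i : subdiv i u w -> back u (inl i) = w.
  case/orP => /andP[/eqP-> /eqP->] /=; first by rewrite eqxx.
  by rewrite eq_sym v_neq.
by rewrite /port; case: ifP => [/hb //|_]; case: ifP => [/hb|].
Qed.

Hypothesis G3 : cubic G.

Lemma truncate_cubic : cubic truncate.
Proof.
move=> k; rewrite -(decK k); case: (dec k) => [i|u].
  have -> : nbrs truncate (enc (inl i)) =
     [set enc (inl (~~ i)); enc (inr v); enc (inr (e i))].
    apply/setP => a; rewrite !inE -(decK a) truncE !(inj_eq (@enc_inj n)).
    by case: (dec a) => [j|w] //=; rewrite ?orbF //; case: i j => [] [].
  rewrite -setUA !cardsU1 cards1 !inE !(inj_eq (@enc_inj n)).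
  have -> : (inr v == inr (e i) :> bool + 'I_n) = (v == e i) by [].
  by rewrite v_neq.
have -> : nbrs truncate (enc (inr u)) = (fun w => enc (port u w)) @: nbrs G u.
  apply/setP => a; rewrite inE -(decK a) truncE; apply/idP/imsetP => [ua|[w]].
    by exists (back u (dec a)); rewrite ?inE ?back_adj ?backK.
  by rewrite inE => uw /enc_inj ->; exact: port_adj.
rewrite card_imset ?G3 // => w1 w2 /enc_inj E.
by rewrite -(portK u w1) E portK.
Qed.

Lemma truncate_connected : connected G -> connected truncate.
Proof.
move=> Gc.
have edge u w : adj G u w -> connect (adj truncate) (enc (inr u)) (enc (inr w)).
  move=> uw; have := portK u w; have := port_adj uw.
  case: (port u w) => [i|w'] h Ew; last first.
    by apply: connect1; rewrite truncE -[w]Ew.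
  have h' : tadj_code (inl i) (inr w).
    by rewrite -Ew /=; case: ifP; rewrite eqxx ?orbT.
  by apply: (connect_trans (y := enc (inl i))); apply: connect1; rewrite truncE.
have old u w : connect (adj truncate) (enc (inr u)) (enc (inr w)).
  have /connectP[p pth ->] := Gc u w.
  elim: p u pth => [|x p IH] u /=; first by move=> _; exact: connect0.
  by case/andP => /edge ux /IH; exact: connect_trans.
have tsym : connect_sym (adj truncate) by apply: sym_connect_sym; exact: adj_sym.
have near k : exists u, connect (adj truncate) k (enc (inr u)).
  rewrite -(decK k); case: (dec k) => [i|u]; last by exists u; exact: connect0.
  by exists v; apply: connect1; rewrite truncE /= eqxx.
move=> k l; have [u ku] := near k; have [w] := near l; rewrite tsym => wl.
exact: connect_trans ku (connect_trans (old u w) wl).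
Qed.

End Truncation.

(** * Godsil-McKay switching *)

(** Switching with a single cell [C]: a vertex outside [C] has no neighbour in [C],
    or half of [C], or all of it, and switching complements its neighbourhood in [C]
    in the second case. This is [gm_cross]: with [d] neighbours in [C] the two
    adjacencies add up to 2 d / |C|, which can only be 0, 1 or 2. *)
Record gm_switch (n : nat) (G H : sgraph n) (C : {set 'I_n}) (r : nat) : Prop :=
  GMSwitch {
    gm_pos : 0 < #|C|;
    gm_regular : {in C, forall i, #|nbrs G i :&: C| = r};
    gm_same : forall i j, (i \in C) = (j \in C) -> adj H i j = adj G i j;
    gm_cross : forall i j, i \notin C -> j \in C ->
      (adj G i j + adj H i j) * #|C| = 2 * #|nbrs G i :&: C|
  }.

Section Similarity.
Local Open Scope ring_scope.

Lemma similar_char_poly (n : nat) (A B P : 'M[algC]_n) :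
  P *m P = 1%:M -> A *m P = P *m B -> char_poly A = char_poly B.
Proof.
move=> PP AP; have := congr1 determinant PP; rewrite det_mulmx det1 => dP.
set P' := map_mx polyC P.
have E : char_poly_mx A *m P' = P' *m char_poly_mx B.
  rewrite /char_poly_mx mulmxBl mulmxBr scalar_mxC -!map_mxM AP //.
have := congr1 determinant E; rewrite !det_mulmx det_map_mx mulrC -/(char_poly A).
move/(congr1 (fun p => (\det P)%:P * p)); rewrite !mulrA -polyCM dP !mul1r; exact.
Qed.

Variables (n : nat) (G H : sgraph n) (C : {set 'I_n}) (r : nat).
Hypothesis sw : gm_switch G H C r.

Let c : algC := #|C|%:R.
Let sgn (i : 'I_n) : algC := if i \in C then -1 else 1.
Let ind (i : 'I_n) : algC := (i \in C)%:R.
(** The matrix of the switching: the identity off [C] and 2 / |C| J - I on [C],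
    where J is the all-ones matrix. *)
Let P : 'M[algC]_n := \matrix_(i, j) ((i == j)%:R * sgn j + 2 / c * ind i * ind j).

Let c_neq0 : c != 0.
Proof. by rewrite pnatr_eq0 -lt0n; exact: gm_pos sw. Qed.

Lemma sum_mulP (F : 'I_n -> algC) j :
  \sum_k F k * P k j = F j * sgn j + 2 / c * ind j * \sum_(k in C) F k.
Proof.
under eq_bigr => k _ do rewrite mxE mulrDr.
rewrite big_split /= (bigD1 j) //= eqxx mul1r big1 ?addr0; last first.
  by move=> k /negPf ->; rewrite !mul0r mulr0.
congr (_ + _); rewrite mulr_sumr [RHS]big_mkcond /=; apply: eq_bigr => k _.
by rewrite /ind; case: (k \in C); rewrite ?mulr0 ?mul0r ?mulr1 ?mulr0 //; ring.
Qed.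

Lemma sum_Pmul (F : 'I_n -> algC) i :
  \sum_k P i k * F k = sgn i * F i + 2 / c * ind i * \sum_(k in C) F k.
Proof.
have PC k : P i k = P k i.
  rewrite !mxE eq_sym; case: eqVneq => [->//|_]; rewrite !mul0r !add0r; ring.
under eq_bigr => k _ do rewrite PC mulrC.
by rewrite sum_mulP mulrC.
Qed.

Lemma sum_ind : \sum_(k in C) 1 = c :> algC.
Proof. by rewrite sumr_const. Qed.

Lemma P_involutive : P *m P = 1%:M.
Proof.
apply/matrixP => i j; rewrite !mxE sum_mulP.
have -> : \sum_(k in C) P i k = ind i.
  transitivity (\sum_k P i k * ind k).
    rewrite big_mkcond; apply: eq_bigr => k _.
    by rewrite /ind; case: (k \in C); rewrite ?mulr1 ?mulr0.
  rewrite sum_Pmul (eq_bigr (fun=> 1)) ?sum_ind; last by move=> k; rewrite /ind => ->.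
  by rewrite /sgn /ind; case: (i \in C) => /=; field.
rewrite mxE /sgn /ind; case: (eqVneq i j) => [->|_]; first by case: (j \in C) => /=; field.
by case: (i \in C); case: (j \in C) => /=; field.
Qed.

Lemma sum_adj (K : sgraph n) i :
  \sum_(k in C) (adjmx K) i k = #|nbrs K i :&: C|%:R.
Proof.
under eq_bigr => k _ do rewrite mxE.
rewrite -natr_sum -big_mkcondr /= sum1_card; congr _%:R; apply: eq_card => k.
by rewrite !inE andbC.
Qed.

Lemma adjmxC (K : sgraph n) i j : adjmx K i j = adjmx K j i.
Proof. by rewrite !mxE adj_sym. Qed.

(** Summing [gm_cross] over [C] shows that complementing half of [C] leaves a half. *)
Lemma gm_degree i : i \notin C -> #|nbrs H i :&: C| = #|nbrs G i :&: C|.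
Proof.
move=> iC.
have dE (K : sgraph n) : #|nbrs K i :&: C| = (\sum_(k in C) adj K i k)%N.
  rewrite -big_mkcondr sum1_card; apply: eq_card => k; by rewrite !inE andbC.
have : (\sum_(k in C) (adj G i k + adj H i k) * #|C| = #|C| * (2 * #|nbrs G i :&: C|))%N.
  by rewrite -sum_nat_const; apply: eq_bigr => k kC; exact: gm_cross sw _ _ iC kC.
rewrite -big_distrl big_split /= -!dE mulnC => /eqP.
by rewrite eqn_pmul2l ?(gm_pos sw) // => /eqP; rewrite mul2n -addnn => /addnI.
Qed.

(** For [i] outside and [j] inside [C] the entries of the two sides are
    2 d / |C| - a and b, for the adjacencies a and b before and after switching:
    this is [gm_cross]. *)
Lemma gm_intertwine : adjmx G *m P = P *m adjmx H.
Proof.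
apply/matrixP => i j; rewrite [LHS]mxE [RHS]mxE sum_mulP sum_Pmul sum_adj.
under eq_bigr => k _ do rewrite adjmxC.
rewrite sum_adj !mxE /sgn /ind.
case: (boolP (i \in C)) (boolP (j \in C)) => [iC|iC] [] jC; rewrite /= ?mulr0 ?mul0r ?addr0.
- rewrite (gm_same sw) ?iC // (gm_regular sw) // .
  have -> : #|nbrs H j :&: C| = r.
    rewrite -(gm_regular sw jC); apply: eq_card => k; rewrite !inE.
    case kC : (k \in C); rewrite ?andbF // (gm_same sw) ?jC ?kC //.
  ring.
- rewrite gm_degree // adj_sym (adj_sym H).
  have := congr1 (fun k => k%:R : algC) (gm_cross sw jC iC).
  rewrite !natrM natrD -/c => E.
  rewrite [2 / c * _]mulr1 mulrAC.
  by rewrite -E mulfK //; ring.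
- have := congr1 (fun k => k%:R : algC) (gm_cross sw iC jC).
  rewrite !natrM natrD -/c => E.
  rewrite [2 / c * _]mulr1 mulrAC.
  by rewrite -E mulfK //; ring.
- by rewrite (gm_same sw) ?(negPf iC) ?(negPf jC) // mulrC.
Qed.

Lemma gm_cospectral : cospectral G H.
Proof.
by move=> a; rewrite (similar_char_poly P_involutive gm_intertwine).
Qed.
End Similarity.

Section SwitchTruncate.
Variables (n : nat) (G H : sgraph n) (C : {set 'I_n}) (r : nat).
Variables (v : 'I_n) (e : bool -> 'I_n).
Hypothesis sw : gm_switch G H C r.
Hypotheses (vC : v \notin C) (eC : forall i, e i \notin C).

Let C' : {set 'I_(2 + n)} := [set enc (inr u : bool + 'I_n) | u in C].

Lemma card_lift : #|C'| = #|C|.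
Proof. by rewrite card_imset // => x y /enc_inj []. Qed.

Lemma mem_lift s : (enc s \in C') = if s is inr u then u \in C else false.
Proof.
apply/imsetP/idP => [[u uC /enc_inj->] //|].
by case: s => // u uC; exists u.
Qed.

Lemma tadj_C (K : sgraph n) s w : w \in C ->
  tadj_code K v e s (inr w) = if s is inr u then adj K u w else false.
Proof.
move=> wC.
have wv : (w == v) = false by apply: contraNF vC => /eqP <-.
have we i : (w == e i) = false by apply: contraNF (eC i) => /eqP <-.
by case: s => [i|u] /=; rewrite /subdiv ?wv ?we ?andbF ?andbT.
Qed.

Lemma card_nbrs_lift (K : sgraph n) s :
  #|nbrs (truncate K v e) (enc s) :&: C'| =
  if s is inr u then #|nbrs K u :&: C| else 0.
Proof.
have mE w : (w \in nbrs (truncate K v e) (enc s) :&: C') =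
    if dec w is inr w' then
      (w' \in C) && (if s is inr u then adj K u w' else false)
    else false.
  rewrite -[in LHS](decK w) !inE truncE mem_lift.
  by case: (dec w) => [i|w']; rewrite ?andbF // andbC; case wC: (w' \in C); rewrite //= tadj_C.
case: s mE => [i|u] mE.
  apply/eqP; rewrite cards_eq0; apply/eqP/setP => w; rewrite mE inE.
  by case: (dec w) => // ?; rewrite andbF.
rewrite -(card_imset (nbrs K u :&: C) (f := fun w => enc (inr w))); last first.
  by move=> x y /enc_inj [].
apply: eq_card => w; rewrite mE; apply/idP/imsetP => [|[w' + ->]]; last first.
  by rewrite encK !inE andbC.
move: (decK w); case: (dec w) => // w' <- /andP[wC uw].
by exists w'; rewrite ?inE ?wC ?uw.
Qed.

(** The new vertices have no neighbour in [C], and no edge inside [C] or from an old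
    vertex to [C] is touched. *)
Lemma truncate_gm_switch : gm_switch (truncate G v e) (truncate H v e) C' r.
Proof.
split; first by rewrite card_lift; exact: gm_pos sw.
- move=> i; rewrite -(decK i) mem_lift card_nbrs_lift.
  by case: (dec i) => // u; exact: gm_regular sw _.
- move=> i j; rewrite -(decK i) -(decK j) !mem_lift !truncE.
  by case: (dec i) (dec j) => [k|u] [l|w] //= E; rewrite (gm_same sw).
- move=> i j; rewrite -(decK i) -(decK j) !mem_lift !truncE card_lift card_nbrs_lift.
  case: (dec j) => // w iC wC; rewrite !tadj_C //.
  by case: (dec i) iC => // u uC; exact: gm_cross sw _ _ uC wC.
Qed.
End SwitchTruncate.

(** * Faces of a truncated graph *)

Section Darts.
Variables (n : nat) (G : sgraph n) (d0 : dart G).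

Definition dart_of u w : dart G := insubd d0 (u, w).

Lemma val_dart_of u w : adj G u w -> val (dart_of u w) = (u, w).
Proof. by move=> uw; rewrite val_insubd /= uw. Qed.

Lemma dart_of_val d : dart_of (val d).1 (val d).2 = d.
Proof. by apply: val_inj; rewrite val_dart_of ?(valP d) //; case: (val d). Qed.

Lemma face_dart_of (rho : rotation G) u w : adj G u w ->
  face_perm rho (dart_of u w) = dart_of w (val rho w u).
Proof.
move=> uw; apply: val_inj; rewrite permE /= (val_dart_of uw) val_dart_of //.
by apply: rot_adj; rewrite adj_sym.
Qed.
End Darts.

Section TruncatedFaces.
Variables (n : nat) (G : sgraph n) (v : 'I_n) (e : bool -> 'I_n).
Hypotheses (ve : forall i, adj G v (e i)) (e_neq : e true != e false).
Hypothesis G3 : cubic G.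

Let T := truncate G v e.
Let T3 : cubic T := truncate_cubic ve e_neq G3.

Definition tnext (rho' : rotation T) (s t : bool + 'I_n) : bool + 'I_n :=
  dec (val rho' (enc s) (enc t)).

(** [rho] is what [rho'] becomes when the edge between the two new vertices is
    deleted and these vertices, now of degree two, are smoothed. *)
Definition lifts (rho : rotation G) (rho' : rotation T) :=
  forall u w, adj G u w -> val rho u w = back v e u (tnext rho' (inr u) (port v e u w)).

Lemma rung_subproof : adj T (enc (inl true)) (enc (inl false)).
Proof. by rewrite truncE. Qed.

Definition rung0 : dart T :=
  Sub (enc (inl true : bool + 'I_n), enc (inl false)) rung_subproof.

Definition tdart (s t : bool + 'I_n) : dart T := dart_of rung0 (enc s) (enc t).
Local Notation tadj := (tadj_code G v e).

Section OneRotation.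
Variable rho' : rotation T.
Local Notation nx := (tnext rho').

Lemma next_adj s t : tadj s t -> tadj s (nx s t).
Proof.
move=> st; rewrite -(truncE G) /tnext decK; apply: rot_adj.
by rewrite truncE.
Qed.

Lemma next_neq s t : tadj s t -> nx s t != t.
Proof.
move=> st; rewrite /tnext -(inj_eq (@enc_inj n)) decK; apply: rot_neq => //.
by rewrite truncE.
Qed.

Lemma next_cube s t : tadj s t -> nx s (nx s (nx s t)) = t.
Proof.
by move=> st; rewrite /tnext !decK rot_cube // ?encK // truncE.
Qed.

Lemma tadjC s t : tadj s t = tadj t s.
Proof. by rewrite -!(truncE G) adj_sym. Qed.

Lemma face_tdart s t : tadj s t -> face_perm rho' (tdart s t) = tdart t (nx t s).
Proof. by move=> st; rewrite /tdart face_dart_of ?truncE // /tnext decK. Qed.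

End OneRotation.

Lemma tdartE d : exists s t, tadj s t /\ d = tdart s t.
Proof.
exists (dec (val d).1), (dec (val d).2); rewrite /tdart !decK dart_of_val; split=> //.
by rewrite -(truncE G) !decK; exact: valP d.
Qed.

Lemma tdart_inj s t s' t' : tadj s t -> tadj s' t' -> tdart s t = tdart s' t' ->
  s = s' /\ t = t'.
Proof.
move=> st st' /(congr1 val); rewrite !val_dart_of ?truncE //.
by case=> /enc_inj -> /enc_inj ->.
Qed.

Lemma tdart_neq s t s' t' : tadj s t -> tadj s' t' -> (s != s') || (t != t') ->
  tdart s t != tdart s' t'.
Proof.
by move=> st st' ne; apply: contraTneq ne => /(tdart_inj st st')[-> ->]; rewrite !eqxx.
Qed.

Lemma reduce_rotation (rho' : rotation T) : exists rho, lifts rho rho'.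
Proof.
apply: rotation_of => // u w uw; have st := port_adj v e uw.
have s1 := next_adj rho' st; have s2 := next_adj rho' s1.
split; first exact: back_adj ve _ _ _.
  apply: contra_neq (next_neq rho' st) => E.
  by rewrite -(backK ve e_neq s1) E.
by rewrite !(backK ve e_neq) // next_cube // (portK ve).
Qed.

(** The darts of the edge between the two new vertices. *)
Definition rung i : dart T := tdart (inl i) (inl (~~ i)).

Section Cut.
Variables (rho : rotation G) (rho' : rotation T).
Hypothesis rr : lifts rho rho'.
Local Notation nx := (tnext rho').
Local Notation phi := (face_perm rho').

(** The face permutation after deleting the edge between the new vertices, as
    [cut_old] and [cut_new] show; its two darts remain as a cycle of their own. *)
Definition cut_perm : {perm dart T} :=
  (phi * tperm (rung true) (phi (rung false)) * tperm (rung false) (phi (rung true)))%g.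

Lemma tadj_rung i : tadj (inl i) (inl (~~ i)).
Proof. by case: i. Qed.

Lemma phi_rung i : phi (rung i) = tdart (inl (~~ i)) (nx (inl (~~ i)) (inl i)).
Proof. by rewrite face_tdart ?tadj_rung. Qed.

Lemma tadj_phi_rung i : tadj (inl (~~ i)) (nx (inl (~~ i)) (inl i)).
Proof. by apply: next_adj; case: i. Qed.

Lemma cut_old s u : tadj s (inr u) -> cut_perm (tdart s (inr u)) = phi (tdart s (inr u)).
Proof.
move=> st; rewrite !permM face_tdart //.
have ut := next_adj rho' (t := s) (s := inr u); rewrite tadjC in ut.
have {}ut := ut st.
have [f0 f1] := (tadj_phi_rung false, tadj_phi_rung true).
by rewrite !phi_rung tpermD ?tpermD // tdart_neq ?tadj_rung.
Qed.

Lemma cut_rung i : cut_perm (rung i) = rung (~~ i).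
Proof.
have [f0 f1] := (tadj_phi_rung false, tadj_phi_rung true).
rewrite !permM !phi_rung; case: i => /=.
  rewrite (tpermD (z := tdart _ (nx _ (inl true)))) ?tpermR //.
    by rewrite tdart_neq ?tadj_rung.
  by rewrite tdart_neq ?tadj_rung.
by rewrite tpermR tpermD // tdart_neq ?tadj_rung.
Qed.

(** The old neighbour of the new vertex [i] that differs from [u]. *)
Definition other i u := if u == v then e i else v.

Lemma otherP i u : tadj (inr u) (inl i) ->
  [/\ tadj (inl i) (inr (other i u)) , other i u != u &
     forall t, tadj (inl i) t -> t = inl (~~ i) \/ t = inr u \/ t = inr (other i u)].
Proof.
have ev : (e i == v) = false by rewrite eq_sym (v_neq ve).
rewrite /= /other => /orP[] /eqP->; rewrite !(eqxx, ev, orbT) ?(v_neq ve) /=;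
  split=> // -[j|w] /=.
- by case: (i) (j) => [] [] //; left.
- by case/orP => /eqP->; right; [left|right].
- by case: (i) (j) => [] [] //; left.
- by case/orP => /eqP->; right; [right|left].
Qed.

(** Whether the rotation at the new vertex goes from [u] to the other old neighbour
    directly or by way of the deleted edge, [cut_perm] passes straight through. *)
Lemma cut_new u i : tadj (inr u) (inl i) ->
  cut_perm (tdart (inr u) (inl i)) = tdart (inl i) (inr (other i u)).
Proof.
move=> st; have [uo ne cases] := otherP st.
have ts : tadj (inl i) (inr u) by rewrite tadjC.
have [f0 f1] := (tadj_phi_rung false, tadj_phi_rung true).
have fi : tadj (inl i) (nx (inl i) (inl (~~ i))).
  by have := tadj_phi_rung (~~ i); rewrite negbK.
have phi_ne j : phi (tdart (inr u) (inl i)) != phi (rung j).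
  by rewrite (inj_eq perm_inj) tdart_neq ?tadj_rung.
have [E|] := cases _ (next_adj rho' ts); last first.
  case=> E; first by have := next_neq rho' ts; rewrite E eqxx.
  have phi_ne' j : phi (rung j) != tdart (inl i) (inr (other i u)).
    by rewrite eq_sym -E -face_tdart.
  have rung_neq j : rung j != tdart (inl i) (inr (other i u)).
    by rewrite tdart_neq ?tadj_rung // orbT.
  by rewrite !permM (face_tdart _ st) E tpermD ?tpermD.
have E' : nx (inl i) (inl (~~ i)) = inr (other i u).
  have := next_neq rho' (tadj_rung i); have := next_cube rho' ts; rewrite E.
  by have [->|[->|//]] := cases _ fi; rewrite ?E ?eqxx.
rewrite !permM face_tdart // E.
case: i {cases phi_ne} st uo ne ts fi E E' => /= st uo ne ts fi E E'.
  rewrite -/(rung true) tpermL !phi_rung /= E' tpermD //.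
    by rewrite tdart_neq ?tadj_rung.
  by rewrite tdart_neq ?tadj_rung.
rewrite -/(rung false) (tpermD (z := rung false)) ?tpermL ?phi_rung /= ?E' //.
  by rewrite tdart_neq ?tadj_rung.
by rewrite tdart_neq ?tadj_rung.
Qed.

(** The first transposition splits or merges according to whether the two darts are
    on one face. After it, [rung false] is followed by [rung true] and then by the
    image of the latter, so the second transposition splits a cycle. *)
Lemma porbits_cut_perm :
  #|porbits cut_perm| = nfaces rho' + (rung true \in porbit phi (rung false)).*2.
Proof.
have rung_neq i : rung (~~ i) != phi (rung i).
  rewrite phi_rung tdart_neq ?tadj_rung ?tadj_phi_rung // negbK eq_sym next_neq ?orbT //.
  by case: i.
have [tf ft] := (rung_neq false, rung_neq true); rewrite /= in tf ft.
pose phi1 := (phi * tperm (rung true) (phi (rung false)))%g.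
have phi1_false : phi1 (rung false) = rung true by rewrite permM tpermR.
have phi1_true : phi1 (rung true) = phi (rung true).
  rewrite permM tpermD //; last by rewrite (inj_eq perm_inj) tdart_neq ?tadj_rung.
  by rewrite phi_rung tdart_neq ?tadj_rung ?tadj_phi_rung.
have := porbits_mulr_tperm phi1 (rung false) (phi (rung true)); rewrite ft.
have -> : rung false \in porbit phi1 (phi (rung true)).
  by rewrite -phi1_true porbit_step -phi1_false porbit_step porbit_id.
rewrite -/cut_perm addn0 => ->.
have := porbits_mulr_tperm phi (rung true) (phi (rung false)).
rewrite tf porbit_step -/phi1 -/(nfaces rho').
by case: (_ \in _) => /=; lia.
Qed.

(** The dart of [G] along which a dart of the truncated graph runs. The darts of the
    new edge run along none and get a default value. *)
Definition unlift_dart (d : dart T) : dart G :=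
  let d0 : dart G := Sub (v, e true) (ve true) in
  match dec (val d).1, dec (val d).2 with
  | inr u, t => dart_of d0 u (back v e u t)
  | inl i, inr w => dart_of d0 (back v e w (inl i)) w
  | inl _, inl _ => d0
  end.

Lemma unlift_tdart s t : tadj s t ->
  let d0 : dart G := Sub (v, e true) (ve true) in
  unlift_dart (tdart s t) = match s, t with
  | inr u, t => dart_of d0 u (back v e u t)
  | inl i, inr w => dart_of d0 (back v e w (inl i)) w
  | inl _, inl _ => d0
  end.
Proof. by move=> st; rewrite /unlift_dart val_dart_of ?truncE //= !encK. Qed.

Lemma port_sym u w : port v e w u = if port v e u w is inl i then inl i else inr u.
Proof. by rewrite /port !(subdivC _ _ _ w u); do 2?[case: ifP => //]. Qed.

Lemma back_back i u : tadj (inr u) (inl i) ->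
  back v e (back v e u (inl i)) (inl i) = u.
Proof.
move=> st; have E := port_sym u (back v e u (inl i)).
by rewrite (backK ve e_neq st) in E; rewrite -[RHS](portK ve (back v e u (inl i))) E.
Qed.

Lemma back_next w s : tadj (inr w) s ->
  back v e w (nx (inr w) s) = val rho w (back v e w s).
Proof. by move=> st; rewrite rr ?(back_adj ve) // (backK ve e_neq st). Qed.

(** Smoothing a vertex of degree two only shortens faces, so the cycles of [cut_perm]
    are the faces of [rho] and the cycle formed by the two darts of the new edge. *)
Lemma porbits_cut_perm_old : #|porbits cut_perm| = (nfaces rho).+1.
Proof.
pose f (d : dart G) := tdart (inr (val d).1) (port v e (val d).1 (val d).2).
pose d0 : dart G := Sub (v, e true) (ve true).
have KE d : (d \in porbit cut_perm (rung true)) = (d == rung true) || (d == rung false).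
  apply/idP/orP => [|[] /eqP->]; last 2 first.
  - exact: porbit_id.
  - by rewrite -(cut_rung true) mem_porbit1.
  have /subsetP : porbit cut_perm (rung true) \subset [set rung true; rung false].
    apply: porbit_sub => [|y]; rewrite !inE ?eqxx //.
    by case/orP => /eqP->; rewrite cut_rung eqxx ?orbT.
  by move/(_ d) => + H => /(_ H); rewrite !inE => /orP.
have fE u w : adj G u w -> f (dart_of d0 u w) = tdart (inr u) (port v e u w).
  by move=> uw; rewrite /f val_dart_of.
have fstep d : cut_perm (f d) = f (face_perm rho d) \/
               cut_perm (cut_perm (f d)) = f (face_perm rho d).
  rewrite -(dart_of_val d0 d); case: d => -[u w] /= uw.
  have wu : adj G w u by rewrite adj_sym.
  rewrite face_dart_of // !fE ?rot_adj //.
  have st := port_adj v e uw; have wk := portK ve u w; have := port_sym u w.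
  have tt' := port_adj v e wu; have uk := portK ve w u.
  rewrite rr //; case E: (port v e u w) st wk => [i|w'] st /= wk E'.
    right; rewrite cut_new // /other wk cut_old; last by rewrite tadjC -E'.
    rewrite face_tdart; last by rewrite tadjC -E'.
    by rewrite -E' (backK ve e_neq) // next_adj.
  left; rewrite wk cut_old; last by rewrite tadjC -E'.
  rewrite face_tdart; last by rewrite tadjC -E'.
  by rewrite -E' (backK ve e_neq) // next_adj.
apply: (porbits_retract (f := f) (r := unlift_dart) (a := rung true)).
- move=> d; rewrite KE /f; case: d => -[u w] /= uw.
  by rewrite !(negPf (tdart_neq _ _ _)) ?tadj_rung ?port_adj.
- move=> d; case: d => -[u w] /= uw; rewrite /f /= unlift_tdart ?port_adj //=.
  by rewrite (portK ve); apply: val_inj; rewrite val_dart_of.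
- move=> d; case: (fstep d) => <-; last first.
    by rewrite -eq_porbit_mem !porbit_step.
  by rewrite mem_porbit1.
- have old_step s w : tadj s (inr w) ->
    unlift_dart (cut_perm (tdart s (inr w))) =
    face_perm rho (dart_of d0 (back v e w s) w).
    move=> st; have ts := st; rewrite tadjC in ts.
    rewrite cut_old // face_tdart // unlift_tdart ?next_adj // back_next //.
    by rewrite face_dart_of // adj_sym (back_adj ve).
  move=> d; have [s [t [st ->]]] := tdartE d; rewrite KE.
  case: s t st => [i|u] [j|w] st; last 3 first.
  + by rewrite old_step // unlift_tdart // mem_porbit1.
  + move=> _; rewrite cut_new // unlift_tdart; last by have [] := otherP st.
    by rewrite (unlift_tdart st) -[other j u]/(back v e u (inl j)) back_back // porbit_id.
  + by rewrite old_step // unlift_tdart // mem_porbit1.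
  by case: i j st => [] [] // _; rewrite -[tdart _ _]/(rung _) ?eqxx ?orbT.
move=> d; have [s [t [st ->]]] := tdartE d; rewrite KE unlift_tdart //.
case: s t st => [i|u] t st.
  case: t st => [j|w] st.
    by case: i j st => [] [] // _; rewrite ?eqxx ?orbT.
  have ts := st; rewrite tadjC in ts.
  rewrite fE; last by rewrite adj_sym (back_adj ve).
  have pE := port_sym w (back v e w (inl i)); rewrite (backK ve e_neq ts) in pE.
  have us : tadj (inr (back v e w (inl i))) (inl i).
    by move: (back_adj ve ts); rewrite adj_sym => /(port_adj v e); rewrite pE.
  have oE : other i (back v e w (inl i)) = w by exact: back_back.
  have := mem_porbit1 cut_perm (tdart (inr (back v e w (inl i))) (inl i)).
  by rewrite cut_new // oE pE porbit_sym.
by rewrite fE ?(back_adj ve) // (backK ve e_neq) // porbit_id.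
Qed.

Lemma nfaces_lift :
  nfaces rho' + (rung true \in porbit (face_perm rho') (rung false)).*2 = (nfaces rho).+1.
Proof. by rewrite -porbits_cut_perm porbits_cut_perm_old. Qed.

End Cut.

Lemma truncate_nfaces_le (rho' : rotation T) :
  exists rho : rotation G, nfaces rho' <= (nfaces rho).+1.
Proof.
have [rho rr] := reduce_rotation rho'; exists rho.
by rewrite -(nfaces_lift rr) leq_addr.
Qed.

(** The rotation at the new vertices is chosen such that the triangle bounds a face.
    The new edge then has this face on one side only. *)
Lemma truncate_nfaces_ex (rho : rotation G) :
  exists rho' : rotation T, nfaces rho' = (nfaces rho).+1.
Proof.
(* Of the two ends of the truncated edges, the one followed by the other. *)
have [i0 turn] : exists i, val rho v (e i) = e (~~ i).
  have [b [c [ab ac bc E]]] := nbrs3 G3 (ve true).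
  have : e false \in nbrs G v by rewrite inE.
  rewrite E !inE (eq_sym _ (e true)) (negPf e_neq) /= => Eb.
  have [[ra rb rc]|[ra rc rb]] := rot_cases G3 rho ab ac bc E.
    case/orP: Eb => /eqP Eb; first by exists true; rewrite ra Eb.
    by exists false; rewrite Eb rc.
  case/orP: Eb => /eqP Eb; first by exists false; rewrite Eb rb.
  by exists true; rewrite ra Eb.
pose F (s t : bool + 'I_n) : bool + 'I_n := match s, t with
  | inr u, _ => port v e u (val rho u (back v e u t))
  | inl i, inl _ => if i == i0 then inr v else inr (e i)
  | inl i, inr w => if i == i0 then (if w == v then inr (e i) else inl (~~ i))
                    else (if w == v then inl (~~ i) else inr v)
  end.
have ev i : (e i == v) = false by rewrite eq_sym (v_neq ve).
have inr_eq u w : (inr u == inr w :> bool + 'I_n) = (u == w) by [].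
have FP s t : tadj s t -> [/\ tadj s (F s t), F s t != t & F s (F s (F s t)) = t].
  case: s => [i|u] st.
    case: t st => [j|w] /=.
      case: i j => [] [] // _; case: (i0) => /=;
      by rewrite !(eqxx, ev, v_neq ve, orbT).
    case/orP => /eqP->; case: i => /=; case: (i0) => /=;
    by rewrite !(eqxx, ev, v_neq ve, orbT) /= ?inr_eq ?(ev, v_neq ve).
  have ub := back_adj ve st; have ur := rot_adj rho ub.
  rewrite /F !(portK ve) rot_cube // (backK ve e_neq st); split=> //.
    exact: port_adj.
  apply: contra_neq (rot_neq G3 rho ub) => E.
  by rewrite -[LHS](portK ve u) E.
have [] := rotation_of (G := T) T3 (f := fun a b => enc (F (dec a) (dec b))).
  move=> a b ab; have := FP (dec a) (dec b).
  rewrite -(truncE G) !decK => /(_ ab)[]; rewrite -(truncE G) !decK !encK => ? ne ->.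
  by split=> //; rewrite ?decK //; apply: contra_neq ne => E; rewrite -[in RHS]E encK.
move=> rho' rE; exists rho'.
have nxE s t : tadj s t -> tnext rho' s t = F s t.
  by move=> st; rewrite /tnext rE ?truncE // !encK.
have rr : lifts rho rho'.
  by move=> u w uw; rewrite nxE ?port_adj //= !(portK ve).
have := nfaces_lift rr.
suff /negPf-> : rung true \notin porbit (face_perm rho') (rung false) by rewrite addn0.
suff : rung i0 \notin porbit (face_perm rho') (rung (~~ i0)).
  by case: i0 {F FP rE nxE turn}; rewrite // porbit_sym.
have n_v i : tadj (inl i) (inr v) by rewrite /= eqxx.
have v_n i : tadj (inr v) (inl i) by rewrite /= eqxx.
(* The face bounded by the triangle. *)
pose A := [set rung (~~ i0); tdart (inl i0) (inr v); tdart (inr v) (inl (~~ i0))].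
have /subsetP subA : porbit (face_perm rho') (rung (~~ i0)) \subset A.
  apply: porbit_sub => [|y]; rewrite !inE ?eqxx //.
  case/orP => [/orP[]|] /eqP->.
  - rewrite phi_rung negbK nxE /= ?eqxx ?orbT //; by case: (i0).
  - rewrite face_tdart // nxE /F; last by rewrite tadjC.
    rewrite [back _ _ _ _]/= eqxx turn (port_subdiv ve e_neq (i := ~~ i0)) ?eqxx ?orbT //.
    by rewrite /subdiv !eqxx.
  - rewrite face_tdart // nxE; last by rewrite tadjC.
    by rewrite /= eqxx; case: (i0) => /=; rewrite eqxx.
apply/negP => /subA; rewrite !inE -!orbA.
rewrite !(negPf (tdart_neq _ _ _)) ?tadj_rung //; by case: (i0).
Qed.
End TruncatedFaces.

(** * Counting the faces of a graph given by a table *)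

Section Search.
Variable T : eqType.

(** The darts into a vertex and the reversed darts, listed in the same order.
    Elimination renames the latter, never the former. *)
Definition star := (seq T * seq T)%type.
Definition shift (b : bool) (s : seq T) := if b then rot 1 s else rotr 1 s.
Definition star_links (b : bool) (x : star) := zip x.1 (shift b x.2).

Definition rotation_links (bs : seq bool) (r : seq star) : seq (T * T) :=
  flatten [seq star_links p.1 p.2 | p <- zip bs r].

(** Either an element of [l] is removed, as in [ncycles_rec], or [l] is exhausted and
    both rotations at the next vertex are tried. The first argument bounds the
    number of steps. *)
Fixpoint max_ncycles (k : nat) (l : seq (T * T)) (r : seq star) : nat :=
  if k is k'.+1 then
    match l, r with
    | (e, s) :: l', _ =>
        (e == s) + max_ncycles k' [seq (p.1, subst e s p.2) | p <- l']
                                  [seq (x.1, map (subst e s) x.2) | x <- r]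
    | [::], x :: r' =>
        maxn (max_ncycles k' (star_links true x) r')
             (max_ncycles k' (star_links false x) r')
    | [::], [::] => 0
    end
  else 0.

Lemma rotation_links_map f bs r :
  [seq (p.1, f p.2) | p <- rotation_links bs r] =
  rotation_links bs [seq (x.1, map f x.2) | x <- r].
Proof.
elim: r bs => [|x r IH] [|b bs] //=.
rewrite /rotation_links /= map_cat; congr (_ ++ _); last exact: IH.
rewrite /star_links /=; have -> : shift b (map f x.2) = map f (shift b x.2).
  by rewrite /shift; case: b; rewrite (map_rot, map_rotr).
by elim: x.1 (shift b x.2) => [|a s IHs] [|c s'] //=; rewrite IHs.
Qed.

(** The steps spent on a star: one to choose its rotation, one per dart. *)
Definition star_size (x : star) := (size x.1).+1.

Lemma max_ncyclesP k l r bs : size bs = size r ->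
  size l + sumn (map star_size r) <= k ->
  ncycles (l ++ rotation_links bs r) <= max_ncycles k l r.
Proof.
elim: k l r bs => [|k IH] [|[e s] l] r bs szb //=.
- by case: r bs szb => [|x r] [|b bs].
- case: r bs szb => [|x r] [|b bs] //= [szb] szk.
  rewrite -[rotation_links _ _]/(star_links b x ++ rotation_links bs r).
  apply: leq_trans (IH _ _ _ szb _) _.
    have := geq_minl (size x.1) (size (shift b x.2)).
    by rewrite /star_links size_zip; move: szk; rewrite /star_size; lia.
  by case: b; rewrite leq_max leqnn ?orbT.
move=> szk; rewrite ncycles_cons leq_add2l map_cat rotation_links_map IH ?size_map //.
by rewrite -map_comp.
Qed.
End Search.

Section Table.
Variables (n : nat) (t : seq (seq nat)).
Local Notation row v := (nth [::] t v).

(** Symmetrised, so that every table defines a graph. *)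
Definition table_adj (i j : 'I_n) : bool :=
  (i != j) && ((val j \in row i) || (val i \in row j)).

Lemma table_sym : symmetric table_adj.
Proof. by move=> i j; rewrite /table_adj eq_sym orbC. Qed.
Lemma table_irr : irreflexive table_adj.
Proof. by move=> i; rewrite /table_adj eqxx. Qed.

Definition table_graph : sgraph n := SGraph table_sym table_irr.

Definition table_darts : seq (nat * nat) :=
  flatten [seq [seq (u, v) | u <- row v] | v <- iota 0 n].

Definition cubic_table : bool :=
  uniq table_darts &&
  all (fun v => [&& size (row v) == 3, uniq (row v), v \notin row v &
                 all (fun u => (u < n) && (v \in row u)) (row v)]) (iota 0 n).

Hypothesis tP : cubic_table.

Lemma rowP (v : 'I_n) : exists a b c : 'I_n,
  [/\ row v = [:: val a; val b; val c], a != b, a != c, b != c &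
      forall u, adj table_graph v u = [|| u == a, u == b | u == c]].
Proof.
have /andP[_ /allP tA] := tP.
have /tA : val v \in iota 0 n by rewrite mem_iota ltn_ord.
case/and4P => /eqP sz ru vr /allP ra.
case E: (row v) sz ru vr ra => [|a [|b [|c []]]] // _ ru vr ra.
have oE x : x \in [:: a; b; c] -> exists y : 'I_n, x = val y.
  by move/ra/andP => [xn _]; exists (Ordinal xn).
have [a' aE] := oE a (mem_head _ _).
have [b' bE] : exists y : 'I_n, b = val y by apply: oE; rewrite !inE eqxx orbT.
have [c' cE] : exists y : 'I_n, c = val y by apply: oE; rewrite !inE eqxx !orbT.
exists a', b', c'; subst a b c; move: ru; rewrite /= !inE negb_or andbT.
rewrite !(inj_eq val_inj) => /andP[/andP[ab ac] bc]; split=> // u.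
rewrite /= /table_adj E !inE !(inj_eq val_inj).
case: eqVneq => [<-|vu] /=; first by move: vr; rewrite !inE !(inj_eq val_inj) => /negPf ->.
case: (boolP [|| u == a', u == b' | u == c']) => //= nu.
apply: contraNF nu => vu'.
have /tA/and4P[_ _ _ /allP/(_ _ vu')/andP[_]] : val u \in iota 0 n by rewrite mem_iota ltn_ord.
by rewrite E !inE !(inj_eq val_inj).
Qed.

Lemma table_cubic : cubic table_graph.
Proof.
move=> v; have [a [b [c [_ ab ac bc E]]]] := rowP v.
have -> : nbrs table_graph v = [set a; b; c].
  by apply/setP => u; rewrite inE E !inE orbA.
by rewrite -setUA !cardsU1 cards1 !inE negb_or ab ac bc.
Qed.

Definition table_stars : seq (star (nat * nat)%type) :=
  [seq ([seq (u, v) | u <- row v], [seq (v, u) | u <- row v]) | v <- iota 0 n].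

(** The booleans record at which vertices the rotation follows the order of the row. *)
Definition turns (rho : rotation table_graph) (b : nat -> bool) :=
  forall v u : 'I_n, adj table_graph v u ->
    val (val rho v u) = (if b v then next else prev) (row v) (val u).

Lemma ex_turns rho : exists b, turns rho b.
Proof.
have : forall v : 'I_n, exists b : bool, forall u : 'I_n, adj table_graph v u ->
    val (val rho v u) = (if b then next else prev) (row v) (val u).
  move=> v; have [a [b [c [-> ab ac bc E]]]] := rowP v.
  have nE : nbrs table_graph v = [set a; b; c].
    by apply/setP => u; rewrite inE E !inE orbA.
  have [ba ca cb] : [/\ b != a, c != a & c != b] by rewrite ![_ == a]eq_sym [c == b]eq_sym.
  have ne := (negPf ab, negPf ba, negPf ac, negPf ca, negPf bc, negPf cb, eqxx).
  have [[ra rb rc]|[ra rc rb]] := rot_cases table_cubic rho ab ac bc nE;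
    [exists true | exists false] => u; rewrite E => /or3P[] /eqP->;
    by rewrite ?(ra, rb, rc) /= !(inj_eq val_inj) !ne.
case/fin_all_exists => b bP.
exists (fun v => if insub v is Some v' then b v' else true) => v u vu.
by rewrite valK; exact: bP.
Qed.

Lemma turns_ex (b : nat -> bool) : exists rho, turns rho b.
Proof.
pose g v := (if b v then next else prev) (row v).
pose f (v u : 'I_n) := insubd u (g v u).
have gP (v u : 'I_n) : adj table_graph v u ->
  [/\ val (f v u) = g v u, adj table_graph v (f v u), f v u != u & g v (g v (g v u)) = u].
  have [x [y [z [rE xy xz yz E]]]] := rowP v.
  have [yx zx zy] : [/\ y != x, z != x & z != y] by rewrite ![_ == x]eq_sym [z == y]eq_sym.
  have ne := (negPf xy, negPf yx, negPf xz, negPf zx, negPf yz, negPf zy, eqxx).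
  have gx : g v x = if b v then y else z.
    by rewrite /g rE; case: (b v); rewrite /= !(inj_eq val_inj) !ne.
  have gy : g v y = if b v then z else x.
    by rewrite /g rE; case: (b v); rewrite /= !(inj_eq val_inj) !ne.
  have gz : g v z = if b v then x else y.
    by rewrite /g rE; case: (b v); rewrite /= !(inj_eq val_inj) !ne.
  rewrite /f E; case: (b v) gx gy gz => gx gy gz /or3P[] /eqP->;
    by rewrite ?(gx, gy, gz) valKd !E ?eqxx ?orbT ?ne; split.
have [] := @rotation_of _ _ table_cubic f.
  move=> v u vu; have [e1 a1 n1 c1] := gP v u vu; split=> //.
  have [e2 a2 _ _] := gP _ _ a1; have [e3 _ _ _] := gP _ _ a2.
  by apply: val_inj; rewrite e3 e2 e1.
by move=> rho rE; exists rho => v u vu; rewrite rE //; have [] := gP _ _ vu.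
Qed.

Lemma nfaces_turns rho b : turns rho b ->
  nfaces rho = ncycles (rotation_links (map b (iota 0 n)) table_stars).
Proof.
move=> rhoE; pose h (d : dart table_graph) := (val (val d).1, val (val d).2).
have hI : injective h.
  by move=> [[u v] ?] [[u' v'] ?] [/val_inj /= ? /val_inj /= ?]; apply: val_inj; congr (_, _).
pose g v := (if b v then next else prev) (row v).
pose next_dart (p : nat * nat) := (p.2, g p.2 p.1).
have hface d : h (face_perm rho d) = next_dart (h d).
  case: d => -[u v] uv; rewrite permE /h /next_dart /=; congr (_, _).
  by apply: rhoE; rewrite adj_sym.
have /andP[tU _] := tP.
have [e eE] : exists e, map h e = table_darts.
  have : {in table_darts, forall p, exists d, h d = p}.
    move=> p /flatten_mapP[w]; rewrite mem_iota => /andP[_ wn] /mapP[u uw ->].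
    have [x [y [z [rE _ _ _ E]]]] := rowP (Ordinal wn); move: uw; rewrite rE !inE.
    have dE (s : 'I_n) : adj table_graph (Ordinal wn) s -> exists d, h d = (val s, w).
      by rewrite adj_sym => sw; exists (Sub (s, Ordinal wn) sw).
    by case/or3P => /eqP->; apply: dE; rewrite E eqxx ?orbT.
  elim: table_darts => [|p s IH] ps; first by exists [::].
  have [e eE] := IH (fun q qs => ps q (mem_behead (s := p :: s) qs)).
  have [d dE] := ps p (mem_head _ _).
  by exists (d :: e); rewrite /= eE dE.
rewrite /nfaces (@porbits_ncycles _ _ e).
- rewrite -(ncycles_inj _ hI) -map_comp.
  have -> : map ((fun p => (h p.1, h p.2)) \o (fun d => (d, face_perm rho d))) e =
            [seq (p, next_dart p) | p <- map h e].
    by rewrite -map_comp; apply: eq_map => d /=; rewrite hface.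
  rewrite eE /table_darts /rotation_links /table_stars map_flatten.
  congr (ncycles (flatten _)); rewrite zip_map -!map_comp; apply/eq_in_map => w.
  rewrite mem_iota => /andP[_ wn]; rewrite /= /star_links /=.
  have [x [y [z [rE xy xz yz _]]]] := rowP (Ordinal wn).
  have [yx zx zy] : [/\ y != x, z != x & z != y] by rewrite ![_ == x]eq_sym [z == y]eq_sym.
  have ne := (negPf xy, negPf yx, negPf xz, negPf zx, negPf yz, negPf zy, eqxx).
  have {}rE : row w = [:: val x; val y; val z] := rE.
  rewrite /next_dart /g rE /= rE /shift.
  by case: (b w); rewrite /= !(inj_eq val_inj) !ne.
- by apply: (map_uniq (f := h)); rewrite eE.
move=> d; rewrite -(mem_map hI) eE; case: d => -[u w] uw.
apply/flatten_mapP; exists (val w); first by rewrite mem_iota ltn_ord.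
apply/mapP; exists (val u) => //; move: uw; rewrite /= table_sym.
have [x [y [z [-> _ _ _ E]]]] := rowP w; rewrite [table_adj _ _]E.
by rewrite !inE !(inj_eq val_inj).
Qed.

Lemma table_nfaces_le k :
  max_ncycles (sumn (map (@star_size _) table_stars)) [::] table_stars <= k ->
  forall rho : rotation table_graph, nfaces rho <= k.
Proof.
move=> max_k rho; have [b rhoE] := ex_turns rho; rewrite (nfaces_turns rhoE).
by apply: leq_trans max_k; apply: (@max_ncyclesP _ _ [::]); rewrite // !size_map.
Qed.

Lemma table_nfaces_ex (b : nat -> bool) :
  exists rho : rotation table_graph,
    nfaces rho = ncycles (rotation_links (map b (iota 0 n)) table_stars).
Proof. by have [rho /nfaces_turns] := turns_ex b; exists rho. Qed.

Definition explore (s : seq nat) : seq nat := undup (s ++ flatten [seq row v | v <- s]).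

Lemma table_connected (v0 : 'I_n) k :
  all (mem (iter k explore [:: val v0])) (iota 0 n) -> connected table_graph.
Proof.
have reach l u : u \in iter l explore [:: val v0] ->
    exists2 w : 'I_n, u = w & connect (adj table_graph) v0 w.
  elim: l u => [|l IH] u /=; first by rewrite inE => /eqP->; exists v0.
  rewrite mem_undup mem_cat => /orP[/IH //|/flatten_mapP[x /IH[w -> v0w] uw]].
  have [a [b [c [E _ _ _ wE]]]] := rowP w.
  have wo (y : 'I_n) : adj table_graph w y ->
      exists2 w : 'I_n, val y = w & connect (adj table_graph) v0 w.
    by move=> wy; exists y => //; apply: connect_trans v0w (connect1 wy).
  by move: uw; rewrite E !inE => /or3P[] /eqP->; apply: wo; rewrite wE eqxx ?orbT.
move=> /allP all_reached.
have from_v0 u : connect (adj table_graph) v0 u.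
  have /all_reached/reach[w /val_inj -> //] : val u \in iota 0 n.
  by rewrite mem_iota ltn_ord.
have csym : connect_sym (adj table_graph) by apply: sym_connect_sym; exact: table_sym.
by move=> u w; apply: connect_trans (from_v0 w); rewrite csym.
Qed.
End Table.

(** * Genus polynomials *)

Section GenusPolynomial.
Variables (n : nat) (G : sgraph n).
Local Open Scope ring_scope.

Definition max_nfaces (k : nat) : Prop :=
  (exists rho : rotation G, nfaces rho = k) /\
  (forall rho : rotation G, (nfaces rho <= k)%N).

Lemma min_genus_of_max_nfaces k (g : rat) :
  max_nfaces k -> g = 1 + n%:R / 4%:R - k%:R / 2%:R -> min_genus_is G g.
Proof.
move=> [[rho rhoE] le_k] ->; split; first by exists rho; rewrite /genus rhoE.
by move=> rho'; rewrite /genus lerD2l lerN2 ler_pM2r ?invr_gt0 ?ltr0n // ler_nat.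
Qed.

(** The coefficient of X^i counts the rotation systems whose genus has integral part
    i, so it is 0 below the minimum and positive at the minimum. *)
Lemma least_exponent_genus_poly g :
  min_genus_is G g%:R -> least_exponent (genus_poly G) = g.
Proof.
move=> [[rho0 rho0E] ge_g].
have coefE i : (genus_poly G)`_i =
    #|[set rho : rotation G | Num.truncn (genus rho) == i]|%:R.
  rewrite coef_sum -sum1_card natr_sum [RHS]big_mkcond /=.
  by apply: eq_bigr => rho _; rewrite coefXn inE eq_sym; case: eqP.
have coef_lt i : (i < g)%N -> (genus_poly G)`_i = 0.
  move=> ig; rewrite coefE; apply/eqP; rewrite pnatr_eq0 cards_eq0.
  apply/eqP/setP => rho; rewrite !inE; apply: contraTF ig => /eqP <-.
  by rewrite -leqNgt truncn_ge_nat //; exact: le_trans (ge_g rho).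
have coef_g : (genus_poly G)`_g != 0.
  rewrite coefE pnatr_eq0 cards_eq0; apply/set0Pn; exists rho0.
  by rewrite inE rho0E natrK.
rewrite /least_exponent; apply/eqP; rewrite eqn_leq; apply/andP; split.
  rewrite leqNgt; apply/negP => /(before_find 0) /=.
  by rewrite coef_g.
rewrite leqNgt; apply/negP => lt_g.
have hasp : has (predC1 0) (genus_poly G).
  rewrite has_find; apply: ltn_trans lt_g _.
  by rewrite ltnNge; apply: contraNN coef_g => /(nth_default 0) ->.
by have := nth_find 0 hasp; rewrite /= coef_lt // eqxx.
Qed.
End GenusPolynomial.

(** * The family *)

(** A graph with a vertex to truncate and the far ends of the two edges to
    subdivide; after truncation the new vertices take the place of these ends. *)
Record cornered (n : nat) := Cornered {
  cgraph :> sgraph n;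
  corner : 'I_n;
  ends : bool -> 'I_n
}.

Definition grow n (M : cornered n) : cornered (2 + n) :=
  Cornered (truncate M (corner M) (ends M)) (enc (inr (corner M)))
           (fun i => enc (inl i)).

Record growable n (M : cornered n) : Prop := Growable {
  growable_cubic : cubic M;
  growable_connected : connected M;
  growable_adj : forall i, adj M (corner M) (ends M i);
  growable_neq : ends M true != ends M false
}.

Lemma grow_growable n (M : cornered n) : growable M -> growable (grow M).
Proof.
case=> M3 Mc Madj Mneq; split.
- exact: truncate_cubic.
- exact: truncate_connected.
- by move=> i; rewrite truncE /= eqxx.
by rewrite (inj_eq (@enc_inj n)).
Qed.

Lemma grow_max_nfaces n (M : cornered n) k :
  growable M -> max_nfaces M k -> max_nfaces (grow M) k.+1.
Proof.
case=> M3 Mc Madj Mneq [[rho rhoE] le_k]; split.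
  have [rho' E] := truncate_nfaces_ex Madj Mneq M3 rho; exists rho'.
  by rewrite E rhoE.
move=> rho'; have [rho1 /leq_trans-> //] := truncate_nfaces_le Madj Mneq M3 rho'.
by rewrite ltnS.
Qed.

Fixpoint tower n (M : cornered n) (s : nat) : cornered (iter s (addn 2) n) :=
  match s return cornered (iter s (addn 2) n) with
  | 0 => M
  | s'.+1 => grow (tower M s')
  end.

Lemma tower_growable n (M : cornered n) s : growable M -> growable (tower M s).
Proof. by move=> gM; elim: s => //= s; exact: grow_growable. Qed.

Lemma tower_max_nfaces n (M : cornered n) s k :
  growable M -> max_nfaces M k -> max_nfaces (tower M s) (s + k).
Proof.
move=> gM Mk; elim: s => //= s; apply: grow_max_nfaces; exact: tower_growable.
Qed.

Lemma tower_cospectral n (M N : cornered n) C r s :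
  gm_switch M N C r -> corner M = corner N -> ends M = ends N ->
  corner M \notin C -> (forall i, ends M i \notin C) ->
  cospectral (tower M s) (tower N s).
Proof.
move=> sw vE eE vC eC.
suff [C' [sw' _ _ _ _]] : exists C', [/\ gm_switch (tower M s) (tower N s) C' r,
    corner (tower M s) = corner (tower N s), ends (tower M s) = ends (tower N s),
    corner (tower M s) \notin C' & forall i, ends (tower M s) i \notin C'].
  exact: gm_cospectral sw'.
elim: s => [|s [C' [sw' vE' eE' vC' eC']]]; first by exists C.
exists [set enc (inr u : bool + _) | u in C']; split=> /=.
- by rewrite -vE' -eE'; exact: truncate_gm_switch.
- by rewrite vE'.
- by [].
- by rewrite mem_lift.
by move=> i; rewrite mem_lift.
Qed.

(** A hexagon 0, ..., 5. The vertices 6, ..., 10 induce a K_{2,3} hanging from 0, 2, 4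
    and the vertices 11, ..., 15 one hanging from 1, 3, 5. *)
Definition cube_table : seq (seq nat) :=
  [:: [:: 1; 5; 6]; [:: 0; 2; 11]; [:: 1; 3; 7]; [:: 2; 4; 12]; [:: 3; 5; 8];
      [:: 4; 0; 13]; [:: 0; 9; 10]; [:: 2; 9; 10]; [:: 4; 9; 10]; [:: 6; 7; 8];
      [:: 6; 7; 8]; [:: 1; 14; 15]; [:: 3; 14; 15]; [:: 5; 14; 15];
      [:: 11; 12; 13]; [:: 11; 12; 13]].

(** The outcome of switching the former graph on [switch_set]. *)
Definition switched_table : seq (seq nat) :=
  [:: [:: 3; 7; 8]; [:: 4; 9; 11]; [:: 5; 6; 8]; [:: 0; 9; 12]; [:: 1; 6; 7];
      [:: 2; 9; 13]; [:: 2; 4; 10]; [:: 0; 4; 10]; [:: 0; 2; 10]; [:: 1; 3; 5];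
      [:: 6; 7; 8]; [:: 1; 14; 15]; [:: 3; 14; 15]; [:: 5; 14; 15];
      [:: 11; 12; 13]; [:: 11; 12; 13]].

(** The truncated vertex and its two neighbours belong to the K_{2,3} that
    [switch_set] avoids. *)
Definition base (t : seq (seq nat)) : cornered 16 :=
  Cornered (table_graph 16 t) (inord 15) (fun i => inord (if i then 11 else 12)).

Definition switch_set : {set 'I_16} := [set i | val i \in [:: 0; 2; 4; 9]].

Lemma ord_all n (P : pred nat) : all P (iota 0 n) -> forall i : 'I_n, P i.
Proof. by move=> /allP Pn i; apply: Pn; rewrite mem_iota ltn_ord. Qed.

Lemma base_growable t : cubic_table 16 t ->
  all (mem (iter 15 (explore t) [:: 0])) (iota 0 16) ->
  (11 \in nth [::] t 15) && (12 \in nth [::] t 15) -> growable (base t).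
Proof.
move=> tP t_conn /andP[t11 t12]; split.
- exact: table_cubic.
- exact: table_connected (ord0 : 'I_16) _ t_conn.
- by case; rewrite /= /table_adj -val_eqE /= !inordK ?t11 ?t12.
by rewrite /= -val_eqE /= !inordK.
Qed.

Lemma cube_cubic : cubic_table 16 cube_table.
Proof. by vm_compute. Qed.

Lemma switched_cubic : cubic_table 16 switched_table.
Proof. by vm_compute. Qed.

Lemma cube_max_nfaces : max_nfaces (base cube_table) 6.
Proof.
split.
  (* The vertices that follow their row in a rotation system with 6 faces. *)
  have [rho E] := table_nfaces_ex cube_cubic (mem [:: 0; 1; 3; 5; 6]).
  by exists rho; rewrite E; vm_compute.
by apply: table_nfaces_le cube_cubic _ _; vm_compute.
Qed.

Lemma switched_max_nfaces : max_nfaces (base switched_table) 8.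
Proof.
split.
  (* The vertices that follow their row in a rotation system with 8 faces. *)
  have [rho E] := table_nfaces_ex switched_cubic (mem [:: 0; 3; 4; 7; 9; 11; 14]).
  by exists rho; rewrite E; vm_compute.
by apply: table_nfaces_le switched_cubic _ _; vm_compute.
Qed.

Lemma card_nat_pred n (P : pred nat) : #|[set i : 'I_n | P i]| = count P (iota 0 n).
Proof. by rewrite cardsE cardE size_filter -enumT -val_enum_ord count_map. Qed.

Lemma base_gm_switch : gm_switch (base cube_table) (base switched_table) switch_set 0.
Proof.
pose S := mem [:: 0; 2; 4; 9].
pose a t i j := (i != j) && ((j \in nth [::] t i) || (i \in nth [::] t j)).
have cardS : #|switch_set| = 4 by rewrite (card_nat_pred 16 S).
have deg (i : 'I_16) : #|nbrs (base cube_table) i :&: switch_set| =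
    count (fun j => a cube_table i j && S j) (iota 0 16).
  by rewrite -card_nat_pred; congr #|pred_of_set _|; apply/setP => j; rewrite !inE.
have pairP (P : nat -> nat -> bool) :
    all (fun i => all (P i) (iota 0 16)) (iota 0 16) -> forall i j : 'I_16, P i j.
  by move/ord_all => Pi i; apply: ord_all.
have memS (i : 'I_16) : (i \in switch_set) = S i by rewrite inE.
split; first by rewrite cardS.
- move=> i; rewrite deg memS => iS; apply/eqP.
  have /ord_all/(_ i)/implyP/(_ iS) := isT : all (fun i => S i ==>
    (count (fun j => a cube_table i j && S j) (iota 0 16) == 0)) (iota 0 16).
  exact.
- move=> i j; rewrite !memS => /eqP SE; apply/eqP.
  have /pairP/(_ i j)/implyP/(_ SE) := isT : all (fun i => all (fun j => (S i == S j) ==>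
    (a switched_table i j == a cube_table i j)) (iota 0 16)) (iota 0 16).
  exact.
move=> i j; rewrite cardS deg !memS => iS jS; apply/eqP.
have /pairP/(_ i j)/implyP/(_ iS)/implyP/(_ jS) := isT : all (fun i => all (fun j =>
  ~~ S i ==> (S j ==> ((a cube_table i j + a switched_table i j) * 4 ==
    2 * count (fun k => a cube_table i k && S k) (iota 0 16)))) (iota 0 16)) (iota 0 16).
exact.
Qed.

Definition cast_order n m (E : n = m) (G : sgraph n) : sgraph m := ecast k (sgraph k) E G.

Lemma tower_order s : iter s (addn 2) 16 = 14 + 2 * s.+1.
Proof. by elim: s => //= s ->; rewrite !mulnS; lia. Qed.

(** The tower starts at order 16, which is the member of index 1. *)
Definition family (M : cornered 16) (t : nat) : sgraph (14 + 2 * t) :=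
  if t is s.+1 return sgraph (14 + 2 * t)
  then cast_order (tower_order s) (tower M s) else table_graph _ [::].

Lemma family_transport (Q : forall n, sgraph n -> sgraph n -> Prop) (M N : cornered 16) t :
  (1 <= t)%N -> (forall s, t = s.+1 -> Q _ (tower M s : sgraph _) (tower N s : sgraph _)) ->
  Q _ (family M t) (family N t).
Proof.
case: t => // s _ /(_ s erefl); rewrite /family /cast_order.
by case: _ / (tower_order s).
Qed.

Theorem theoremD :
  exists G H : forall t : nat, sgraph (14 + 2 * t),
    forall t : nat, (1 <= t)%N ->
      (connected (G t) /\ cubic (G t)) /\
      (connected (H t) /\ cubic (H t)) /\
      cospectral (G t) (H t) /\
      min_genus_is (G t) 2%:R%R /\
      min_genus_is (H t) 1%R /\
      genus_poly (G t) <> genus_poly (H t) /\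
      least_exponent (genus_poly (G t)) <> least_exponent (genus_poly (H t)).
Proof.
exists (family (base cube_table)), (family (base switched_table)) => t t1.
have growG : growable (base cube_table).
  by apply: base_growable cube_cubic _ _; vm_compute.
have growH : growable (base switched_table).
  by apply: base_growable switched_cubic _ _; vm_compute.
set G := family (base cube_table) t; set H := family (base switched_table) t.
suff [Gc Hc cosp gG gH] : [/\ connected G /\ cubic G, connected H /\ cubic H,
    cospectral G H, min_genus_is G 2%:R%R & min_genus_is H 1%R].
  have le_ne : least_exponent (genus_poly G) <> least_exponent (genus_poly H).
    by rewrite (least_exponent_genus_poly gG) (least_exponent_genus_poly (g := 1) gH).
  exact (conj Gc (conj Hc (conj cosp (conj gG (conj gH
    (conj (fun E => le_ne (congr1 least_exponent E)) le_ne)))))).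
apply: (family_transport (Q := fun n G H => [/\ connected G /\ cubic G,
  connected H /\ cubic H, cospectral G H, min_genus_is G 2%:R%R & min_genus_is H 1%R]))
  => // s _.
have [cG kG _ _] := tower_growable s growG; have [cH kH _ _] := tower_growable s growH.
split=> //.
- apply: (tower_cospectral s base_gm_switch); rewrite ?inE /= ?inordK //.
  by case; rewrite inE /= inordK.
(* 2 = 1 + (16 + 2 s) / 4 - (s + 6) / 2, and likewise 1 with 8 in place of 6. *)
- apply: (min_genus_of_max_nfaces (tower_max_nfaces s growG cube_max_nfaces)).
  by rewrite tower_order mulnS !natrD; field.
apply: (min_genus_of_max_nfaces (tower_max_nfaces s growH switched_max_nfaces)).
by rewrite tower_order mulnS !natrD; field.
Qed.
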